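(* Let $a<b$, $\tau>0$, $0<\alpha<1$, $\tilde a=a/\tau$, $\tilde b=b/\tau$, and let $L:\mathbb{R}^3\to\mathbb{R}$, $(x,v,t)\mapsto L(x,v,t)$, be a $C^\infty$ Lagrangian. Let $L_n(x,y,u)=L(x,\frac{y}{\tau},\tau u)$ be the associated temporally nondimensionalized Lagrangian. Let $\frac{d^\alpha}{dt^\alpha}$ be a (linear) fractional derivative operator, acting on $C^\infty([a,b])$ in the variable $t$ and, as $\frac{d^\alpha}{du^\alpha}$, on $C^\infty([\tilde a,\tilde b])$ in the variable $u$, and suppose that for all $x\in C^\infty([a,b])$ and all $t\in[a,b]$, $$\tau^\alpha\,\frac{d^\alpha}{dv^\alpha}x(v)\Big|_{v=t}=\frac{d^\alpha}{du^\alpha}\tilde x(u)\Big|_{u=t/\tau},\qquad\text{where }\tilde x:u\in[\tilde a,\tilde b]\mapsto x(u\tau).$$ Then, for $x\in C^\infty([a,b])$, the function $x:t\mapsto x(t)$ is a solution of $$\forall t\in[a,b],\quad \partial_1L\Big(x(t),\tau^{\alpha-1}\frac{d^\alpha}{dt^\alpha}x(t),t\Big)-\tau^{\alpha-1}\frac{d^\alpha}{dt^\alpha}\,\partial_2L\Big(x(t),\tau^{\alpha-1}\frac{d^\alpha}{dt^\alpha}x(t),t\Big)=0$$ if and only if $\tilde x:u\mapsto x(u\tau)$ is a solution of $$\forall u\in[\tilde a,\tilde b],\quad \partial_1L_n\Big(\tilde x(u),\frac{d^\alpha}{du^\alpha}\tilde x(u),u\Big)-\frac{d^\alpha}{du^\alpha}\,\partial_2L_n\Big(\tilde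 x(u),\frac{d^\alpha}{du^\alpha}\tilde x(u),u\Big)=0.$$
   Context: $\partial_1,\partial_2$ denote partial derivatives with respect to the first and second variables. The notation $\frac{d^\alpha}{dt^\alpha}$ stands for an unspecified fractional derivative: a linear operator $C^\infty([a,b])\to C^\infty([a,b])$ for functions of $t\in[a,b]$, together with its counterpart $\frac{d^\alpha}{du^\alpha}:C^\infty([\tilde a,\tilde b])\to C^\infty([\tilde a,\tilde b])$ for functions of $u\in[\tilde a,\tilde b]$; the only link between them used is the scaling condition stated in the claim. In the two equations, $\frac{d^\alpha}{dt^\alpha}\partial_2L(\dots)$ means the operator applied to the function $t\mapsto\partial_2L\big(x(t),\tau^{\alpha-1}\frac{d^\alpha}{dt^\alpha}x(t),t\big)$, and $\frac{d^\alpha}{du^\alpha}\partial_2L_n(\dots)$ means the operator applied to $u\mapsto\partial_2L_n\big(\tilde x(u),\frac{d^\alpha}{du^\alpha}\tilde x(u),u\big)$. The constant $\tau$ is a fixed (time) constant. *)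

(* Defs.v *)
From Stdlib Require Import Reals.
From Coquelicot Require Import Coquelicot.
Open Scope R_scope.

(* The difference quotient is restricted to [a, b], so the derivative is
   one-sided at the endpoints and ignores values of [f] outside [a, b]. *)
Definition is_derive_on (a b : R) (f : R -> R) (t l : R) : Prop :=
  filterlim (fun s => (f s - f t) / (s - t))
    (within (fun s => a <= s <= b) (locally' t)) (locally l).

(* [F k] is the [k]-th derivative of [f] on [a, b]. *)
Definition Cinf_on (a b : R) (f : R -> R) : Prop :=
  exists F : nat -> R -> R,
    (forall t, a <= t <= b -> F O t = f t) /\
    (forall k t, a <= t <= b -> is_derive_on a b (F k) t (F (S k) t)).

(* A linear operator from C^oo([a, b]) to itself. An element of C^oo([a, b]) is
   represented by any function [R -> R] with the given values on [a, b];
   [op_ext] says that the operator does not depend on the representative. *)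
Record linear_operator_on (a b : R) (D : (R -> R) -> R -> R) : Prop := {
  op_Cinf : forall f, Cinf_on a b f -> Cinf_on a b (D f);
  op_ext : forall f g, Cinf_on a b f -> Cinf_on a b g ->
    (forall t, a <= t <= b -> f t = g t) ->
    forall t, a <= t <= b -> D f t = D g t;
  op_plus : forall f g, Cinf_on a b f -> Cinf_on a b g ->
    forall t, a <= t <= b -> D (fun s => f s + g s) t = D f t + D g t;
  op_scal : forall (c : R) f, Cinf_on a b f ->
    forall t, a <= t <= b -> D (fun s => c * f s) t = c * D f t
}.

Definition partial1 (L : R -> R -> R -> R) (x v t : R) : R :=
  Derive (fun z => L z v t) x.
Definition partial2 (L : R -> R -> R -> R) (x v t : R) : R :=
  Derive (fun z => L x z t) v.
Definition partial3 (L : R -> R -> R -> R) (x v t : R) : R :=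
  Derive (fun z => L x v z) t.

(* The partial derivatives of order at most [n] exist and are jointly
   continuous on R^3. *)
Fixpoint Cn3 (n : nat) (L : R -> R -> R -> R) : Prop :=
  (forall p : R * R * R,
     continuous (fun q : R * R * R => L (fst (fst q)) (snd (fst q)) (snd q)) p) /\
  match n with
  | O => True
  | S m =>
      (forall x v t : R,
         ex_derive (fun z => L z v t) x /\
         ex_derive (fun z => L x z t) v /\
         ex_derive (fun z => L x v z) t) /\
      Cn3 m (partial1 L) /\ Cn3 m (partial2 L) /\ Cn3 m (partial3 L)
  end.

Definition Cinf3 (L : R -> R -> R -> R) : Prop := forall n, Cn3 n L.

Definition nondim_lagrangian (tau : R) (L : R -> R -> R -> R) : R -> R -> R -> R :=
  fun x y u => L x (y / tau) (tau * u).

Definition nondim_path (tau : R) (x : R -> R) : R -> R := fun u => x (u * tau).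

(* Main.v *)
Require Import Defs.
From Stdlib Require Import Reals Lra.
From Coquelicot Require Import Coquelicot.
Open Scope R_scope.

(** The scaling condition intertwines the two operators on every smooth curve.
    Applied to [x] it identifies the arguments of [L] and [L_n]; applied to the
    momentum [t |-> d_2 L (x t, ..., t)] it gives the second term, the chain rule
    [d_2 L_n = d_2 L / tau] turning [tau^alpha] into [tau^(alpha - 1)]. The
    analytic content is that the momentum is again smooth on [[a, b]], so that the
    condition and the extensionality of the operators apply to it. *)

(** * Limits and one-sided derivatives relative to a closed interval *)

(** The filter underlying [is_derive_on], named so that its [Filter] instance can be supplied to
    limit lemmas. As [t] is arbitrary, the filter may be trivial. *)
Definition interval_filter (a b t : R) : (R -> Prop) -> Prop :=
  within (fun s => a <= s <= b) (locally' t).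

Global Instance interval_filter_filter (a b t : R) : Filter (interval_filter a b t).
Proof. unfold interval_filter; apply within_filter, within_filter, locally_filter. Qed.

Lemma interval_filter_neq (a b t : R) : interval_filter a b t (fun s => s <> t).
Proof.
  unfold interval_filter, within, locally', within.
  apply filter_forall; auto.
Qed.

Lemma interval_filter_in (a b t : R) : interval_filter a b t (fun s => a <= s <= b).
Proof.
  unfold interval_filter, within, locally', within.
  apply filter_forall; auto.
Qed.

Lemma interval_filter_id (a b t : R) :
  filterlim (fun s => s) (interval_filter a b t) (locally t).
Proof.
  intros P HP; unfold filtermap, interval_filter, within, locally', within.
  apply filter_imp with (2 := HP); auto.
Qed.

Lemma filterlim_Rplus {T : Type} (F : (T -> Prop) -> Prop) {FF : Filter F}
  (f g : T -> R) (l m : R) :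
  filterlim f F (locally l) -> filterlim g F (locally m) ->
  filterlim (fun s => f s + g s) F (locally (l + m)).
Proof.
  intros Hf Hg.
  exact (filterlim_comp_2 _ _ _ Hf Hg (filterlim_plus (V := R_NormedModule) l m)).
Qed.

Lemma filterlim_Rmult {T : Type} (F : (T -> Prop) -> Prop) {FF : Filter F}
  (f g : T -> R) (l m : R) :
  filterlim f F (locally l) -> filterlim g F (locally m) ->
  filterlim (fun s => f s * g s) F (locally (l * m)).
Proof.
  intros Hf Hg.
  exact (filterlim_comp_2 _ _ _ Hf Hg (filterlim_mult (K := R_AbsRing) l m)).
Qed.

(** For [s <> t], [f s] equals [f t] plus the slope times [s - t], and the slope has a finite
    limit. *)
Lemma is_derive_on_continuous (a b : R) (f : R -> R) (t l : R) :
  is_derive_on a b f t l -> filterlim f (interval_filter a b t) (locally (f t)).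
Proof.
  intros Hf.
  apply filterlim_ext_loc with (fun s => f t + (f s - f t) / (s - t) * (s + - t)).
  - apply filter_imp with (2 := interval_filter_neq a b t).
    intros s Hs; field; lra.
  - replace (locally (f t)) with (locally (f t + l * (t + - t))) by (f_equal; ring).
    apply (filterlim_Rplus (interval_filter _ _ _)); [apply filterlim_const |].
    apply (filterlim_Rmult (interval_filter _ _ _)); [exact Hf |].
    apply (filterlim_Rplus (interval_filter _ _ _)); [apply interval_filter_id | apply filterlim_const].
Qed.

Lemma is_derive_on_plus (a b : R) (f g : R -> R) (t l m : R) :
  is_derive_on a b f t l -> is_derive_on a b g t m ->
  is_derive_on a b (fun s => f s + g s) t (l + m).
Proof.
  intros Hf Hg; unfold is_derive_on; fold (interval_filter a b t).
  apply filterlim_ext_loc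
    with (fun s => (f s - f t) / (s - t) + (g s - g t) / (s - t)).
  - apply filter_imp with (2 := interval_filter_neq a b t).
    intros s Hs; field; lra.
  - apply (filterlim_Rplus (interval_filter _ _ _)); assumption.
Qed.

Lemma is_derive_on_mult (a b : R) (f g : R -> R) (t l m : R) :
  is_derive_on a b f t l -> is_derive_on a b g t m ->
  is_derive_on a b (fun s => f s * g s) t (l * g t + f t * m).
Proof.
  intros Hf Hg; unfold is_derive_on; fold (interval_filter a b t).
  apply filterlim_ext_loc
    with (fun s => (f s - f t) / (s - t) * g s + f t * ((g s - g t) / (s - t))).
  - apply filter_imp with (2 := interval_filter_neq a b t).
    intros s Hs; field; lra.
  - apply (filterlim_Rplus (interval_filter _ _ _)); apply (filterlim_Rmult (interval_filter _ _ _)).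
    + exact Hf.
    + exact (is_derive_on_continuous _ _ _ _ _ Hg).
    + apply filterlim_const.
    + exact Hg.
Qed.

Lemma is_derive_on_const (a b c t : R) : is_derive_on a b (fun _ => c) t 0.
Proof.
  unfold is_derive_on; fold (interval_filter a b t).
  apply filterlim_ext with (fun _ => 0); [| apply filterlim_const].
  intros s; unfold Rdiv; ring.
Qed.

Lemma is_derive_on_scal (a b c : R) (f : R -> R) (t l : R) :
  is_derive_on a b f t l -> is_derive_on a b (fun s => c * f s) t (c * l).
Proof.
  intros Hf; replace (c * l) with (0 * f t + c * l) by ring.
  exact (is_derive_on_mult _ _ _ _ _ _ _ (is_derive_on_const a b c t) Hf).
Qed.

Lemma is_derive_on_id (a b t : R) : is_derive_on a b (fun s => s) t 1.
Proof.
  unfold is_derive_on; fold (interval_filter a b t).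
  apply filterlim_ext_loc with (fun _ => 1); [| apply filterlim_const].
  apply filter_imp with (2 := interval_filter_neq a b t).
  intros s Hs; field; lra.
Qed.

(** * Dilation of the time variable *)

Lemma div_le_mul_iff (a b tau u : R) : 0 < tau ->
  a / tau <= u <= b / tau <-> a <= u * tau <= b.
Proof.
  intros Htau; rewrite <- Rle_div_l, <- Rle_div_r by lra; reflexivity.
Qed.

Lemma is_derive_on_dilate (a b tau : R) (f : R -> R) (u l : R) : 0 < tau ->
  is_derive_on a b f (u * tau) l ->
  is_derive_on (a / tau) (b / tau) (fun w => f (w * tau)) u (tau * l).
Proof.
  intros Htau Hf; unfold is_derive_on; fold (interval_filter (a / tau) (b / tau) u).
  apply filterlim_ext_loc
    with (fun w => tau * ((f (w * tau) - f (u * tau)) / (w * tau - u * tau))).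
  - apply filter_imp with (2 := interval_filter_neq (a / tau) (b / tau) u).
    intros w Hw; field; split; [lra |].
    rewrite <- Rmult_minus_distr_r; apply Rmult_integral_contrapositive; lra.
  - apply (filterlim_Rmult (interval_filter _ _ _)); [apply filterlim_const |].
    apply filterlim_comp with (2 := Hf).
    (* The map [w |-> w * tau] must respect the punctured filters: nearness comes from continuity,
       [w * tau <> u * tau] from [tau <> 0], and membership in the interval from
       [div_le_mul_iff]. *)
    intros P HP.
    assert (Hlim : filterlim (fun w => w * tau)
      (interval_filter (a / tau) (b / tau) u) (locally (u * tau))).
    { apply (filterlim_Rmult (interval_filter _ _ _)); [apply interval_filter_id | apply filterlim_const]. }
    pose proof (Hlim (fun y => y <> u * tau -> a <= y <= b -> P y) HP) as HlimP.
    unfold filtermap in HlimP |- *.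
    apply filter_imp with (2 := filter_and _ _ HlimP (filter_and _ _
      (interval_filter_neq (a / tau) (b / tau) u)
      (interval_filter_in (a / tau) (b / tau) u))).
    intros w (HPw & Hw & Hin); apply HPw.
    + intros E; apply Hw, (Rmult_eq_reg_r tau); lra.
    + now apply div_le_mul_iff.
Qed.

(** * Smooth functions on an interval *)

Lemma Cinf_on_ext (a b : R) (f g : R -> R) :
  (forall t, a <= t <= b -> f t = g t) -> Cinf_on a b f -> Cinf_on a b g.
Proof.
  intros E (F & H0 & HS); exists F; split; [| exact HS].
  intros t Ht; rewrite H0, E; auto.
Qed.

Lemma Cinf_on_scal (a b c : R) (f : R -> R) :
  Cinf_on a b f -> Cinf_on a b (fun t => c * f t).
Proof.
  intros (F & H0 & HS); exists (fun k t => c * F k t); split.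
  - intros t Ht; now rewrite H0.
  - intros k t Ht; apply is_derive_on_scal; auto.
Qed.

Lemma Cinf_on_dilate (a b tau : R) (f : R -> R) : 0 < tau ->
  Cinf_on a b f -> Cinf_on (a / tau) (b / tau) (nondim_path tau f).
Proof.
  intros Htau (F & H0 & HS); exists (fun k u => tau ^ k * F k (u * tau)); split.
  - intros u Hu; unfold nondim_path; simpl.
    rewrite H0 by now apply div_le_mul_iff.
    ring.
  - intros k u Hu.
    replace (tau ^ S k * F (S k) (u * tau))
      with (tau ^ k * (tau * F (S k) (u * tau))) by (simpl; ring).
    apply is_derive_on_scal.
    apply (is_derive_on_dilate a b tau (F k)); [assumption |].
    apply HS; now apply div_le_mul_iff.
Qed.

(** If differentiation is a map [d] on a syntax [T] for functions, iterating [d] produces all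
    successive derivatives, so no closed formula for them has to be found. *)
Lemma Cinf_on_of_derivation (a b : R) (T : Type) (ev : T -> R -> R) (d : T -> T) :
  (forall e t, a <= t <= b -> is_derive_on a b (ev e) t (ev (d e) t)) ->
  forall e, Cinf_on a b (ev e).
Proof.
  intros H e; exists (fun k => ev (Nat.iter k d e)); split.
  - reflexivity.
  - intros k t Ht; apply H, Ht.
Qed.

Lemma Cinf_on_id (a b : R) : Cinf_on a b (fun t => t).
Proof.
  (* [None] encodes the identity and [Some c] the constant [c]. *)
  apply (Cinf_on_of_derivation a b (option R)
    (fun e => match e with None => fun t => t | Some c => fun _ => c end)
    (fun e => match e with None => Some 1 | Some _ => Some 0 end)) with (e := None).
  intros [c |] t _; [apply is_derive_on_const | apply is_derive_on_id].
Qed.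

(** * The chain rule in three variables *)

(* By the mean value theorem the slope of [f (., p s)] between [x0] and [x s] is a
   value of [f'] near [(x0, p0)]. *)
Lemma partial_increment (U : UniformSpace) (F : (R -> Prop) -> Prop) {FF : Filter F}
  (f f' : R -> U -> R) (x q : R -> R) (p : R -> U) (x0 l : R) (p0 : U) (t : R) :
  (forall z u, is_derive (fun y => f y u) z (f' z u)) ->
  continuous (fun z : R * U => f' (fst z) (snd z)) (x0, p0) ->
  filterlim x F (locally x0) -> filterlim p F (locally p0) ->
  filterlim (fun s => (x s - x0) / (s - t)) F (locally l) ->
  filterlim (fun s => (f (x s) (p s) - f x0 (p s)) / (s - t)) F
    (locally (f' x0 p0 * l)).
Proof.
  intros Hd Hc Hx Hp Hq.
  (* Where [x s = x0] both sides of the factorization vanish; the value [f' x0 (p s)] is chosen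
     there so that [slope] still tends to [f' x0 p0]. *)
  set (slope s := if Req_EM_T (x s) x0 then f' x0 (p s)
                  else (f (x s) (p s) - f x0 (p s)) / (x s - x0)).
  apply filterlim_ext with (fun s => slope s * ((x s - x0) / (s - t))).
  { intros s; unfold slope; destruct (Req_EM_T (x s) x0) as [-> | Hn].
    - unfold Rdiv; ring.
    - unfold Rdiv.
      rewrite (Rmult_comm (x s - x0)), <- Rmult_assoc.
      rewrite !Rmult_assoc, (Rmult_comm (/ (s - t))), <- (Rmult_assoc (/ (x s - x0))).
      rewrite Rinv_l by lra; ring. }
  apply (filterlim_Rmult F); [| exact Hq].
  apply filterlim_locally; intros eps.
  destruct (proj1 (filterlim_locally _ _) Hc eps) as [del Hdel].
  generalize (filter_and _ _ (proj1 (filterlim_locally _ _) Hx del)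
                             (proj1 (filterlim_locally _ _) Hp del)).
  apply filter_imp; intros s [Hxs Hps]; unfold slope.
  destruct (Req_EM_T (x s) x0) as [E | Hn].
  - apply (Hdel (x0, p s)); split; [apply ball_center | exact Hps].
  - destruct (MVT_gen (fun y => f y (p s)) x0 (x s) (fun z => f' z (p s)))
      as (xi & Hxi & E).
    + intros z _; apply Hd.
    + intros z _; apply derivable_continuous_pt.
      exists (f' z (p s)); apply is_derive_Reals, Hd.
    + rewrite E; unfold Rdiv.
      rewrite Rmult_assoc, Rinv_r, Rmult_1_r by lra.
      apply (Hdel (xi, p s)); split; [| exact Hps].
      change (Rabs (xi - x0) < del); change (Rabs (x s - x0) < del) in Hxs.
      revert Hxi Hxs; unfold Rmin, Rmax, Rabs.
      destruct (Rle_dec x0 (x s)), (Rcase_abs (xi - x0)), (Rcase_abs (x s - x0)); lra.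
Qed.

Lemma Cinf3_ex_derive (L : R -> R -> R -> R) (HL : Cinf3 L) (x v t : R) :
  ex_derive (fun z => L z v t) x /\ ex_derive (fun z => L x z t) v /\
  ex_derive (fun z => L x v z) t.
Proof. exact (proj1 (proj2 (HL 1%nat)) x v t). Qed.

Lemma Cinf3_partial1 (L : R -> R -> R -> R) : Cinf3 L -> Cinf3 (partial1 L).
Proof. intros HL n; apply (HL (S n)). Qed.

Lemma Cinf3_partial2 (L : R -> R -> R -> R) : Cinf3 L -> Cinf3 (partial2 L).
Proof. intros HL n; apply (HL (S n)). Qed.

Lemma Cinf3_partial3 (L : R -> R -> R -> R) : Cinf3 L -> Cinf3 (partial3 L).
Proof. intros HL n; apply (HL (S n)). Qed.

(** Joint continuity is transported to an arbitrary space [U], so that the variable being moved can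
    be separated from the other two, with arguments in [R * (R * R)]. *)
Lemma Cinf3_continuous (L : R -> R -> R -> R) (U : UniformSpace)
  (f g h : U -> R) (p : U) : Cinf3 L ->
  continuous f p -> continuous g p -> continuous h p ->
  continuous (fun q => L (f q) (g q) (h q)) p.
Proof.
  intros HL Hf Hg Hh.
  apply (continuous_comp (fun q => (f q, g q, h q))
    (fun q : R * R * R => L (fst (fst q)) (snd (fst q)) (snd q))).
  - apply (continuous_comp_2 (fun q => (f q, g q)) h pair); [| exact Hh |].
    + apply (continuous_comp_2 f g pair); [exact Hf | exact Hg |].
      intros P [d H]; exists d; intros [y z] [Hy Hz]; apply H; split; assumption.
    + intros P [d H]; exists d; intros [y z] [Hy Hz]; apply H; split; assumption.
  - apply (proj1 (HL O)).
Qed.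

Lemma is_derive_on_comp3 (a b : R) (L : R -> R -> R -> R) (x y z : R -> R)
  (t x' y' z' : R) : Cinf3 L ->
  is_derive_on a b x t x' -> is_derive_on a b y t y' -> is_derive_on a b z t z' ->
  is_derive_on a b (fun s => L (x s) (y s) (z s)) t
    (partial1 L (x t) (y t) (z t) * x' + partial2 L (x t) (y t) (z t) * y'
     + partial3 L (x t) (y t) (z t) * z').
Proof.
  intros HL Hx Hy Hz.
  pose proof (is_derive_on_continuous _ _ _ _ _ Hx) as Cx.
  pose proof (is_derive_on_continuous _ _ _ _ _ Hy) as Cy.
  pose proof (is_derive_on_continuous _ _ _ _ _ Hz) as Cz.
  unfold is_derive_on; fold (interval_filter a b t).
  apply filterlim_ext with (fun s =>
    (L (x s) (y s) (z s) - L (x t) (y s) (z s)) / (s - t)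
    + (L (x t) (y s) (z s) - L (x t) (y t) (z s)) / (s - t)
    + (L (x t) (y t) (z s) - L (x t) (y t) (z t)) / (s - t)).
  { intros s; unfold Rdiv; ring. }
  assert (Hpair : forall f g : R -> R, forall u v : R,
    filterlim f (interval_filter a b t) (locally u) ->
    filterlim g (interval_filter a b t) (locally v) ->
    filterlim (fun s => (f s, g s)) (interval_filter a b t) (locally (u, v))).
  { intros f g u v Hf Hg; apply filterlim_locally; intros eps.
    generalize (filter_and _ _ (proj1 (filterlim_locally _ _) Hf eps)
                               (proj1 (filterlim_locally _ _) Hg eps)).
    apply filter_imp; intros s [H1 H2]; split; assumption. }
  assert (C1 : forall w : R * (R * R),
    continuous (fun q : R * (R * R) => fst q) w) by (intros; apply continuous_fst).
  assert (C2 : forall w : R * (R * R),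
    continuous (fun q : R * (R * R) => fst (snd q)) w).
  { intros; apply (continuous_comp snd fst);
      [apply continuous_snd | apply continuous_fst]. }
  assert (C3 : forall w : R * (R * R),
    continuous (fun q : R * (R * R) => snd (snd q)) w).
  { intros; apply (continuous_comp snd snd); apply continuous_snd. }
  pose proof (Cinf3_ex_derive L HL) as HD.
  apply (filterlim_Rplus (interval_filter _ _ _)); [apply (filterlim_Rplus (interval_filter _ _ _)) |].
  - apply (partial_increment (prod_UniformSpace R_UniformSpace R_UniformSpace)
      (interval_filter a b t)
      (fun v u => L v (fst u) (snd u)) (fun v u => partial1 L v (fst u) (snd u))
      x x (fun s => (y s, z s)) (x t) x' (y t, z t) t); auto.
    + intros v u; exact (Derive_correct _ _ (proj1 (HD v (fst u) (snd u)))).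
    + apply Cinf3_continuous; auto using Cinf3_partial1.
  - apply (partial_increment (prod_UniformSpace R_UniformSpace R_UniformSpace)
      (interval_filter a b t)
      (fun v u => L (fst u) v (snd u)) (fun v u => partial2 L (fst u) v (snd u))
      y y (fun s => (x t, z s)) (y t) y' (x t, z t) t); auto.
    + intros v u; exact (Derive_correct _ _ (proj1 (proj2 (HD (fst u) v (snd u))))).
    + apply Cinf3_continuous; auto using Cinf3_partial2.
    + apply Hpair; [apply filterlim_const | exact Cz].
  - apply (partial_increment (prod_UniformSpace R_UniformSpace R_UniformSpace)
      (interval_filter a b t)
      (fun v u => L (fst u) (snd u) v) (fun v u => partial3 L (fst u) (snd u) v)
      z z (fun s => (x t, y t)) (z t) z' (x t, y t) t); auto.
    + intros v u; exact (Derive_correct _ _ (proj2 (proj2 (HD (fst u) (snd u) v)))).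
    + apply Cinf3_continuous; auto using Cinf3_partial3.
    + apply filterlim_const.
Qed.

(** * Smoothness of composites *)

(* A formal algebra closed under differentiation: the successive derivatives of a
   composite [L (x t) (y t) (z t)] can then be written down without Faa di Bruno's
   formula. [e_fst k] stands for the [k]-th derivative of [x], etc. *)
Inductive expr : Type :=
| e_comp (L : R -> R -> R -> R) (HL : Cinf3 L)
| e_fst (k : nat)
| e_snd (k : nat)
| e_thd (k : nat)
| e_plus (e1 e2 : expr)
| e_mult (e1 e2 : expr).

Fixpoint expr_eval (X Y Z : nat -> R -> R) (e : expr) (t : R) : R :=
  match e with
  | e_comp L _ => L (X O t) (Y O t) (Z O t)
  | e_fst k => X k t
  | e_snd k => Y k t
  | e_thd k => Z k t
  | e_plus e1 e2 => expr_eval X Y Z e1 t + expr_eval X Y Z e2 t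
  | e_mult e1 e2 => expr_eval X Y Z e1 t * expr_eval X Y Z e2 t
  end.

(** The smoothness proof stored in [e_comp] makes this total: each partial derivative inherits a
    proof of its own. *)
Fixpoint expr_deriv (e : expr) : expr :=
  match e with
  | e_comp L HL =>
      e_plus (e_plus (e_mult (e_comp (partial1 L) (Cinf3_partial1 L HL)) (e_fst 1))
                     (e_mult (e_comp (partial2 L) (Cinf3_partial2 L HL)) (e_snd 1)))
             (e_mult (e_comp (partial3 L) (Cinf3_partial3 L HL)) (e_thd 1))
  | e_fst k => e_fst (S k)
  | e_snd k => e_snd (S k)
  | e_thd k => e_thd (S k)
  | e_plus e1 e2 => e_plus (expr_deriv e1) (expr_deriv e2)
  | e_mult e1 e2 => e_plus (e_mult (expr_deriv e1) e2) (e_mult e1 (expr_deriv e2))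
  end.

Lemma Cinf_on_comp3 (a b : R) (L : R -> R -> R -> R) (x y z : R -> R) : Cinf3 L ->
  Cinf_on a b x -> Cinf_on a b y -> Cinf_on a b z ->
  Cinf_on a b (fun t => L (x t) (y t) (z t)).
Proof.
  intros HL (X & X0 & XS) (Y & Y0 & YS) (Z & Z0 & ZS).
  (* The zeroth derivatives [X O], [Y O], [Z O] agree with [x], [y], [z] only on the interval. *)
  apply Cinf_on_ext with (expr_eval X Y Z (e_comp L HL)).
  { intros t Ht; simpl; now rewrite X0, Y0, Z0. }
  apply (Cinf_on_of_derivation a b expr (expr_eval X Y Z) expr_deriv).
  intros e t Ht; induction e; simpl.
  - apply is_derive_on_comp3; auto.
  - now apply XS.
  - now apply YS.
  - now apply ZS.
  - now apply is_derive_on_plus.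
  - now apply is_derive_on_mult.
Qed.

(** * Equivalence of the two Euler-Lagrange equations *)

Lemma partial2_nondim (tau : R) (L : R -> R -> R -> R) (HL : Cinf3 L) (x y u : R) :
  partial2 (nondim_lagrangian tau L) x y u = / tau * partial2 L x (y / tau) (tau * u).
Proof.
  unfold partial2, nondim_lagrangian; apply is_derive_unique.
  apply (is_derive_comp (fun z => L x z (tau * u)) (fun z => z / tau)).
  - exact (Derive_correct _ _
      (proj1 (proj2 (Cinf3_ex_derive L HL x (y / tau) (tau * u))))).
  - unfold Rdiv; auto_derive; [exact I | ring].
Qed.

Theorem theorem6 (a b tau alpha : R) (L : R -> R -> R -> R)
  (Dt Du : (R -> R) -> R -> R)
  (Hab : a < b) (Htau : 0 < tau) (Halpha : 0 < alpha < 1)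
  (HL : Cinf3 L)
  (HDt : linear_operator_on a b Dt)
  (HDu : linear_operator_on (a / tau) (b / tau) Du)
  (Hscale : forall x : R -> R, Cinf_on a b x -> forall t : R, a <= t <= b ->
     Rpower tau alpha * Dt x t = Du (nondim_path tau x) (t / tau))
  (x : R -> R) (Hx : Cinf_on a b x) :
  (forall t : R, a <= t <= b ->
     partial1 L (x t) (Rpower tau (alpha - 1) * Dt x t) t
     - Rpower tau (alpha - 1)
       * Dt (fun s => partial2 L (x s) (Rpower tau (alpha - 1) * Dt x s) s) t
     = 0)
  <->
  (forall u : R, a / tau <= u <= b / tau ->
     partial1 (nondim_lagrangian tau L)
       (nondim_path tau x u) (Du (nondim_path tau x) u) u
     - Du (fun w => partial2 (nondim_lagrangian tau L)
             (nondim_path tau x w) (Du (nondim_path tau x) w) w) u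
     = 0).
Proof.
  set (c := Rpower tau (alpha - 1)).
  set (g := fun s => partial2 L (x s) (c * Dt x s) s).
  set (gn := fun w => partial2 (nondim_lagrangian tau L)
    (nondim_path tau x w) (Du (nondim_path tau x) w) w).
  assert (Hc : Rpower tau alpha = c * tau).
  (* The third occurrence is the lone factor [tau], read as [tau] to the power 1. *)
  { unfold c; rewrite <- (Rpower_1 tau) at 3 by exact Htau.
    rewrite <- Rpower_plus; f_equal; ring. }
  assert (Hg : Cinf_on a b g).
  { apply Cinf_on_comp3.
    - now apply Cinf3_partial2.
    - exact Hx.
    - apply Cinf_on_scal, HDt, Hx.
    - apply Cinf_on_id. }
  (* The scaling condition at [t = u * tau]; it is used below for both [x] and the momentum [g]. *)
  assert (HDun : forall f, Cinf_on a b f -> forall u, a / tau <= u <= b / tau ->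
    Du (nondim_path tau f) u = c * tau * Dt f (u * tau)).
  { intros f Hf u Hu; rewrite <- Hc, Hscale by (try apply div_le_mul_iff; auto).
    f_equal; field; lra. }
  (* The second arguments match because [Du (nondim_path tau x) u / tau] is [c * Dt x (u * tau)]. *)
  assert (Hgn : forall u, a / tau <= u <= b / tau ->
    / tau * nondim_path tau g u = gn u).
  { intros u Hu; unfold gn, g; rewrite partial2_nondim by exact HL.
    rewrite HDun by auto; unfold nondim_path.
    f_equal; f_equal; [field; lra | ring]. }
  pose proof (Cinf_on_dilate a b tau g Htau Hg) as Hng.
  (* [gn] is known to be [/ tau] times the dilated momentum only on the interval, so [op_ext] swaps
     them; linearity then extracts [/ tau], which cancels the [tau] in [c * tau]. *)
  assert (HDgn : forall u, a / tau <= u <= b / tau -> Du gn u = c * Dt g (u * tau)).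
  { intros u Hu.
    pose proof (Cinf_on_scal _ _ (/ tau) _ Hng) as Hsc.
    rewrite <- (op_ext _ _ _ HDu _ gn Hsc (Cinf_on_ext _ _ _ _ Hgn Hsc) Hgn u Hu).
    rewrite (op_scal _ _ _ HDu) by auto.
    rewrite HDun by auto; field; lra. }
  (* The two left-hand sides coincide at [u] and [t = u * tau]. *)
  assert (Heq : forall u, a / tau <= u <= b / tau ->
    partial1 (nondim_lagrangian tau L)
      (nondim_path tau x u) (Du (nondim_path tau x) u) u - Du gn u
    = partial1 L (x (u * tau)) (c * Dt x (u * tau)) (u * tau) - c * Dt g (u * tau)).
  { intros u Hu; rewrite HDgn, HDun by auto.
    (* The dilations leave the first variable alone, so this identity holds by conversion. *)
    change (partial1 (nondim_lagrangian tau L)) with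
      (fun y v w => partial1 L y (v / tau) (tau * w)); cbv beta.
    unfold nondim_path; f_equal; f_equal; [field; lra | ring]. }
  split.
  - intros H u Hu; rewrite Heq by exact Hu.
    now apply H, div_le_mul_iff.
  - intros H t Ht.
    (* Every [t] in the interval is reached, from [u = t / tau]. *)
    assert (E : t / tau * tau = t) by (field; lra).
    assert (Hu : a / tau <= t / tau <= b / tau).
    { apply div_le_mul_iff; [exact Htau | now rewrite E]. }
    specialize (H _ Hu); rewrite Heq, E in H by exact Hu; exact H.
Qed.
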